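(* Let $b,b_1,b_2$ be integers. Each of the following pairs of multiplications $( *_1,*_2)$ defines a $2$-multi-rack on $\mathbb{Z}$: 1) $x *_1 y = x$, $\ x *_2 y = x$; 2) $x *_1 y = 2y - x$, $\ x *_2 y = x$; 3.1) $x *_1 y = x + b_1$, $\ x *_2 y = x + b_2$; 3.2) $x *_1 y = x$, $\ x *_2 y = -x + b$; 3.3) $x *_1 y = -x + b$, $\ x *_2 y = x$; 3.4) $x *_1 y = -x + b$, $\ x *_2 y = -x + b$.
   Context: A rack is a non-empty set $X$ with a binary operation $*$ such that for any $x,y\in X$ there is a unique $z\in X$ with $x=z*y$, and $(x*y)*z=(x*z)*(y*z)$ for all $x,y,z\in X$. A $2$-multi-rack is a non-empty set $X$ with two rack operations $*_1,*_2$ such that for any $i,j\in\{1,2\}$ $$(x *_i y) *_j z = (x *_j z) *_i (y *_j z)\qquad\text{for all } x,y,z\in X.$$ *)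

(* Defs.v *)
From mathcomp Require Import all_boot all_algebra.
Set Implicit Arguments.
Unset Strict Implicit.
Unset Printing Implicit Defensive.

Record is_rack (X : Type) (op : X -> X -> X) : Prop := IsRack {
  rack_nonempty : inhabited X;
  rack_div : forall x y : X, exists! z : X, x = op z y;
  rack_distr : forall x y z : X, op (op x y) z = op (op x z) (op y z)
}.

(* The indices 1, 2 of the operations are the elements 0, 1 of 'I_2. *)
Definition op_pair (X : Type) (op1 op2 : X -> X -> X) (i : 'I_2) : X -> X -> X :=
  if i == ord0 then op1 else op2.

Record is_2multirack (X : Type) (op1 op2 : X -> X -> X) : Prop := Is2Multirack {
  multirack_rack : forall i : 'I_2, is_rack (op_pair op1 op2 i);
  multirack_distr : forall (i j : 'I_2) (x y z : X),
    op_pair op1 op2 j (op_pair op1 op2 i x y) z =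
    op_pair op1 op2 i (op_pair op1 op2 j x z) (op_pair op1 op2 j y z)
}.

(* Main.v *)
Require Import Defs.
From mathcomp Require Import all_boot all_algebra.
From mathcomp Require Import ring.
Set Implicit Arguments.
Unset Strict Implicit.
Unset Printing Implicit Defensive.
Import GRing.Theory.
Local Open Scope ring_scope.

(** Two observations cover all six pairs.

    If neither operation depends on its right argument, that is
    [x *_1 y = f x] and [x *_2 y = g x], then unique division says that [f] and
    [g] are bijective, and each mixed distributivity law says that two of the
    maps [f], [g] commute ([perm_2multirack]).  Apart from the second pair, every
    [f] and [g] in the statement is the identity, a translation or a reflection
    [x |-> b - x] of the integers.  In each of these pairs the two maps are equal,
    or both are translations, or one is the identity, so they commute.

    The second pair consists of the core rack [2 * y - x] of an abelian group
    and the trivial operation, and the trivial operation can be added to any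
    rack ([rack_trivial_2multirack]). *)

(** Being injective gives uniqueness in the division axiom, so the
    axiom amounts to having a two-sided inverse for each right translation. *)
Lemma rack_of_inverse (X : Type) (op inv : X -> X -> X) :
  inhabited X ->
  (forall y, cancel (op^~ y) (inv^~ y)) ->
  (forall y, cancel (inv^~ y) (op^~ y)) ->
  (forall x y z, op (op x y) z = op (op x z) (op y z)) ->
  is_rack op.
Proof.
move=> X_inh opK invK distr; split=> // x y.
by exists (inv x y); split=> [|z ->]; [rewrite invK | rewrite opK].
Qed.

Lemma perm_rack (X : Type) (f : X -> X) :
  inhabited X -> bijective f -> is_rack (fun x _ : X => f x).
Proof.
by move=> X_inh [g fK gK]; apply: (rack_of_inverse (inv := fun x _ => g x)).
Qed.

(** For operations that ignore their right argument, the law for the pair of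
    indices [(i, j)] is the commutation of the two maps involved. *)
Lemma perm_2multirack (X : Type) (f g : X -> X) :
  inhabited X -> bijective f -> bijective g -> (forall x, f (g x) = g (f x)) ->
  is_2multirack (fun x _ : X => f x) (fun x _ : X => g x).
Proof.
move=> X_inh f_bij g_bij fgC; split=> [i | i j x y z]; rewrite /op_pair.
  by case: (i == ord0); apply: perm_rack.
by case: (i == ord0); case: (j == ord0).
Qed.

(** When one of the two operations is trivial, both sides of the mixed laws
    reduce to the same application of the other operation. *)
Lemma rack_trivial_2multirack (X : Type) (op : X -> X -> X) :
  is_rack op -> is_2multirack op (fun x _ : X => x).
Proof.
move=> [X_inh op_div op_distr]; split=> [i | i j x y z]; rewrite /op_pair.
  case: (i == ord0); first by split.
  by apply: perm_rack => //; exists id.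
by case: (i == ord0); case: (j == ord0).
Qed.

(** Right translation by [y] is the point reflection at [y], which is its own
    inverse. *)
Lemma core_rack (R : comNzRingType) : is_rack (fun x y : R => 2 * y - x).
Proof.
apply: (rack_of_inverse (inv := fun x y => 2 * y - x)) => [|y x|y x|x y z].
- exact: (inhabits 0).
- by ring.
- by ring.
- by ring.
Qed.

Lemma translation_bij (V : zmodType) (b : V) : bijective (fun x => x + b).
Proof. by exists (fun x => x - b) => x; rewrite ?addrK ?subrK. Qed.

Lemma reflection_bij (V : zmodType) (b : V) : bijective (fun x => - x + b).
Proof.
by exists (fun x => - x + b) => x; rewrite opprD opprK subrK.
Qed.

Theorem proposition4p5 (b b1 b2 : int) :
  is_2multirack (fun x y : int => x) (fun x y : int => x) /\
  is_2multirack (fun x y : int => 2 * y - x) (fun x y : int => x) /\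
  is_2multirack (fun x y : int => x + b1) (fun x y : int => x + b2) /\
  is_2multirack (fun x y : int => x) (fun x y : int => - x + b) /\
  is_2multirack (fun x y : int => - x + b) (fun x y : int => x) /\
  is_2multirack (fun x y : int => - x + b) (fun x y : int => - x + b).
Proof.
have int_inh : inhabited int by exact: (inhabits 0).
have id_bij : bijective (fun x : int => x) by exists id.
have refl_bij := reflection_bij b.
split; first exact: (perm_2multirack int_inh id_bij id_bij).
split; first exact: rack_trivial_2multirack (core_rack _).
split.
  apply: (perm_2multirack int_inh (translation_bij b1) (translation_bij b2)).
  by move=> x; rewrite addrAC.
split; first exact: (perm_2multirack int_inh id_bij refl_bij).
split; first exact: (perm_2multirack int_inh refl_bij id_bij).
exact: (perm_2multirack int_inh refl_bij refl_bij).
Qed.
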